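(* Let $(R,\mathfrak m,k)$ be an $F$-finite Noetherian local ring of prime characteristic $p>0$, and let $\mathfrak b\subseteq R$ be an $\mathfrak m$-primary ideal. Let $\operatorname{gr}_{\mathfrak m}(R)=\bigoplus_{i\ge 0}\mathfrak m^i/\mathfrak m^{i+1}$ be the associated graded ring, let $\mathfrak n=\bigoplus_{i\ge 1}\mathfrak m^i/\mathfrak m^{i+1}$ be its maximal homogeneous ideal, and let $I=\operatorname{gr}_{\mathfrak m}(\mathfrak b)\subseteq \operatorname{gr}_{\mathfrak m}(R)$ be the initial ideal of $\mathfrak b$. Then $$c^{\mathfrak b}(\mathfrak m)\le c^{I}(\mathfrak n),$$ where $c^{\mathfrak b}(\mathfrak m)$ is the $F$-threshold of $\mathfrak m$ with respect to $\mathfrak b$ in $R$ and $c^{I}(\mathfrak n)$ is the $F$-threshold of $\mathfrak n$ with respect to $I$ in $\operatorname{gr}_{\mathfrak m}(R)$.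
   Context: A ring $R$ of characteristic $p$ is $F$-finite if $F^e_*R$ (that is, $R$ viewed as an $R$-module via restriction of scalars along the $e$-th iterate of Frobenius, $f\mapsto f^{p^e}$) is a finitely generated $R$-module for some (equivalently, all) $e>0$. For an ideal $J$ of a ring of characteristic $p$, $J^{[p^e]}$ denotes the ideal generated by $\{f^{p^e}: f\in J\}$. For ideals $\mathfrak a,J$ of a Noetherian ring of characteristic $p$ with $\mathfrak a\subseteq\sqrt J$, set $\nu^{J}_{\mathfrak a}(p^e)=\max\{t\in\mathbb N : \mathfrak a^t\not\subseteq J^{[p^e]}\}$; the $F$-threshold of $\mathfrak a$ with respect to $J$ is $c^{J}(\mathfrak a)=\lim_{e\to\infty}\nu^{J}_{\mathfrak a}(p^e)/p^e$ (this limit is known to exist). For an ideal $\mathfrak b\subseteq R$, the initial ideal is $\operatorname{gr}_{\mathfrak m}(\mathfrak b)=\bigoplus_{i\ge0}\frac{\mathfrak b\cap\mathfrak m^i}{\mathfrak b\cap\mathfrak m^{i+1}}$, identified with the homogeneous ideal $\bigoplus_{i\ge 0}\frac{(\mathfrak b\cap\mathfrak m^i)+\mathfrak m^{i+1}}{\mathfrak m^{i+1}}$ of $\operatorname{gr}_{\mathfrak m}(R)$. *)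

(* Defs.v *)
From HB Require Import structures.
From mathcomp Require Import all_boot all_order all_algebra.
From mathcomp Require Import boolp classical_sets reals topology normedtype.
From mathcomp Require Import sequences.

Set Implicit Arguments.
Unset Strict Implicit.
Unset Printing Implicit Defensive.

Import Order.TTheory GRing.Theory Num.Theory.
Import numFieldNormedType.Exports.

Local Open Scope classical_set_scope.
Local Open Scope quotient_scope.
Local Open Scope ring_scope.

Section Ideals.
Variable R : comNzRingType.
Implicit Types I J M : set R.

(* Unlike [idealr] of ring_quotient, the unit ideal is allowed. *)
Definition ideal I : Prop :=
  [/\ I 0, forall x y, I x -> I y -> I (x + y)
    & forall a x, I x -> I (a * x)].

Definition ideal_gen (S : set R) : set R := smallest ideal S.

Definition ideal_mul I J : set R :=
  ideal_gen [set z | exists x y, [/\ I x, J y & z = x * y]].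

Definition ideal_exp I (n : nat) : set R := iter n (ideal_mul I) setT.

Definition radical I : set R := [set x | exists n : nat, I (x ^+ n)].

Definition noetherian : Prop :=
  forall I, ideal I ->
    exists (n : nat) (g : 'I_n -> R), I = ideal_gen (range g).

Definition maximal_ideal M : Prop :=
  [/\ ideal M, M <> setT
    & forall I, ideal I -> M `<=` I -> I = M \/ I = setT].

Definition local_ring M : Prop :=
  maximal_ideal M /\ forall M', maximal_ideal M' -> M' = M.

Definition primary_ideal I : Prop :=
  [/\ ideal I, I <> setT
    & forall x y, I (x * y) -> I x \/ radical I y].

Definition primary_to M I : Prop := primary_ideal I /\ radical I = M.

(* J^[q], for q a power of the characteristic *)
Definition frob_power J (q : nat) : set R :=
  ideal_gen [set z | exists2 f, J f & z = f ^+ q].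

(* The maximum of { t | a^t is not contained in J^[q] }
   (0 if that maximum does not exist). *)
Definition nu (a J : set R) (q : nat) : nat :=
  let T := [set t : nat | ~ (ideal_exp a t `<=` frob_power J q)] in
  xget 0%N [set t | T t /\ forall s : nat, T s -> (s <= t)%N].

(* c^J(a), as a limit in the real numbers K *)
Definition F_threshold (K : realType) (p : nat) (J a : set R) : K :=
  limn (fun e : nat => (nu a J (p ^ e))%:R / (p ^ e)%:R : K).

Lemma ideal_gen_ideal (S : set R) : ideal (ideal_gen S).
Proof.
split=> [A [[]] //|x y Hx Hy A AS|a x Hx A AS].
  by have [[_ + _] _] := AS; apply; [exact: Hx | exact: Hy].
by have [[_ _ +] _] := AS; apply; exact: Hx.
Qed.

Lemma ideal_opp I x : ideal I -> I x -> I (- x).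
Proof. by case=> _ _ H /(H (-1)); rewrite mulN1r. Qed.

Lemma ideal_exp_ideal I n : ideal (ideal_exp I n).
Proof. by case: n => [|n]; [split | exact: ideal_gen_ideal]. Qed.

Lemma ideal_mul_closed I J x y : I x -> J y -> ideal_mul I J (x * y).
Proof. by move=> Ix Jy; apply: sub_gen_smallest; exists x, y. Qed.

Lemma ideal_exp_mul I i j x y :
  ideal_exp I i x -> ideal_exp I j y -> ideal_exp I (i + j) (x * y).
Proof.
elim: i x => [|i IHi] x Hx Hy.
  by have [_ _] := ideal_exp_ideal I j; apply.
have [E0 ED EM] := ideal_exp_ideal I (i.+1 + j).
suff: ideal_gen [set z | exists u v, [/\ I u, ideal_exp I i v & z = u * v]]
        `<=` [set x | ideal_exp I (i.+1 + j) (x * y)] by apply.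
apply: smallest_sub.
  split=> /= [|u v Hu Hv|a u Hu]; first by rewrite mul0r.
    by rewrite mulrDl; apply: ED.
  by rewrite -mulrA; apply: EM.
move=> _ [u [v [Iu Hv ->]]] /=; rewrite -mulrA.
by apply: ideal_mul_closed => //; exact: IHi.
Qed.

Lemma ideal_exp_subS I n : ideal_exp I n.+1 `<=` ideal_exp I n.
Proof.
have En := ideal_exp_ideal I n.
apply: smallest_sub => // _ [x [y [_ Hy ->]]].
by have [_ _] := En; apply.
Qed.

Lemma ideal_exp1 I : ideal I -> ideal_exp I 1 = I.
Proof.
move=> HI; apply/seteqP; split=> [|x Ix].
  apply: smallest_sub => // _ [x [y [Ix _ ->]]].
  by have [_ _] := HI; rewrite mulrC; apply.
by rewrite -[x]mulr1; apply: ideal_mul_closed.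
Qed.

Lemma maximal_ideal_N1 M : maximal_ideal M -> ~ M 1.
Proof.
case=> [[_ _ HM] MT _ M1]; apply: MT.
by apply/seteqP; split=> // x _; rewrite -[x]mulr1; apply: HM.
Qed.

End Ideals.

Section FFinite.

Definition finitely_generated (A : pzRingType) (M : lmodType A) : Prop :=
  exists (n : nat) (g : 'I_n -> M),
    forall x, exists c : 'I_n -> A, x = \sum_i c i *: g i.

(* F^e_* R: the abelian group R, on which a acts as multiplication by
   a ^+ (p ^ e). *)
Definition frob_push (R : comNzRingType) (p : nat) (chRp : p \in [pchar R])
  (e : nat) : Type := R.

Context (R : comNzRingType) (p : nat) (chRp : p \in [pchar R]) (e : nat).

HB.instance Definition _ := GRing.Zmodule.copy (frob_push chRp e) R.

Definition frob_scale (a : R) (x : frob_push chRp e) : frob_push chRp e :=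
  a ^+ (p ^ e) * (x : R).

Lemma frob_scaleA a b x :
  frob_scale a (frob_scale b x) = frob_scale (a * b) x.
Proof. by rewrite /frob_scale exprMn mulrA. Qed.

Lemma frob_scale1 : left_id 1 frob_scale.
Proof. by move=> x; rewrite /frob_scale expr1n mul1r. Qed.

Lemma frob_scaleDr : right_distributive frob_scale +%R.
Proof. by move=> a x y; rewrite /frob_scale mulrDr. Qed.

Lemma frob_scaleDl x : {morph frob_scale^~ x : a b / a + b}.
Proof.
move=> a b; rewrite /frob_scale -mulrDl; congr (_ * _).
have H c : c ^+ (p ^ e) = iter e (pFrobenius_aut chRp) c.
  elim: {x a b} e c => [|n IHn] c; first by rewrite expr1.
  by rewrite iterS -IHn pFrobenius_autE -exprM expnSr.
by rewrite !H; elim: {H} e => // n IHn; rewrite !iterS IHn rmorphD.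
Qed.

HB.instance Definition _ := GRing.Zmodule_isLmodule.Build R (frob_push chRp e)
  frob_scaleA frob_scale1 frob_scaleDr frob_scaleDl.

End FFinite.

Definition F_finite (R : comNzRingType) (p : nat) (chRp : p \in [pchar R]) :=
  exists e : nat, (0 < e)%N /\ finitely_generated (frob_push chRp e).

(* The associated graded ring.  The direct sum of the m^i / m^(i+1) is
   realised as the quotient of the direct sum of the m^i by the direct sum of
   the m^(i+1); an element (f_i)_i of the former is encoded as the polynomial
   \sum_i f_i 'X^i, so that the product of polynomials is the graded product. *)
Section AssociatedGraded.
Variables (R : comNzRingType) (m : set R).

Definition rees_pred : {pred {poly R}} :=
  fun f => `[< forall i, ideal_exp m i f`_i >].

Lemma rees_subring : subring_closed rees_pred.
Proof.
split=> [|f g|f g]; try move=> /asboolP Hf /asboolP Hg;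
  apply/asboolP=> i; have [E0 ED EM] := ideal_exp_ideal m i.
- by rewrite coef1; case: eqVneq => [->|_]; [exact: Logic.I | exact: E0].
- by rewrite coefB; apply: ED (Hf i) (ideal_opp (ideal_exp_ideal m i) (Hg i)).
- rewrite coefM; elim/big_ind: _ => // -[j /= lt_j] _.
  have -> : ideal_exp m i = ideal_exp m (j + (i - j)) by rewrite subnKC.
  exact: ideal_exp_mul.
Qed.

HB.instance Definition _ :=
  GRing.isSubringClosed.Build {poly R} rees_pred rees_subring.

Record rees := Rees { rees_val :> {poly R}; _ : rees_val \in rees_pred }.
HB.instance Definition _ := [isSub for rees_val].
HB.instance Definition _ := [Choice of rees by <:].
HB.instance Definition _ := [SubChoice_isSubComNzRing of rees by <:].

Lemma reesP (f : rees) i : ideal_exp m i f`_i.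
Proof. by have /asboolP := valP f. Qed.

Lemma rees_monom_subproof i x : ideal_exp m i x -> x *: 'X^i \in rees_pred.
Proof.
move=> Hx; apply/asboolP=> j; rewrite coefZ coefXn.
have [E0 _ _] := ideal_exp_ideal m j.
by case: eqVneq => [->|_]; rewrite ?mulr1 ?mulr0.
Qed.

Hypothesis hm : local_ring m.

Definition gr_ideal : {pred rees} :=
  fun f => `[< forall i, ideal_exp m i.+1 f`_i >].

Lemma gr_ideal_idealr : idealr_closed gr_ideal.
Proof.
split=> [||f g h /asboolP Hg /asboolP Hh].
- by apply/asboolP=> i; rewrite coef0; case: (ideal_exp_ideal m i.+1).
- apply/asboolP=> /(_ 0%N); have [[mI _ _] _] := hm.
  rewrite coef1 ideal_exp1 //.
  by apply: maximal_ideal_N1; case: hm.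
- apply/asboolP=> i; have [E0 ED EM] := ideal_exp_ideal m i.+1.
  rewrite coefD; apply: (ED) (Hh i); rewrite coefM.
  elim/big_ind: _ => [||j _]; [exact: E0 | exact: ED |].
  have := ideal_exp_mul (reesP f j) (Hg (i - j)%N).
  by rewrite addnS subnKC // -ltnS.
Qed.

HB.instance Definition _ := isIdealr.Build rees gr_ideal gr_ideal_idealr.

Definition gr : Type := {ideal_quot gr_ideal}.
HB.instance Definition _ := GRing.ComNzRing.on gr.
HB.instance Definition _ := NzRingQuotient.on gr.

(* For x in m^i, the class of x in the summand m^i / m^(i+1) of gr
   (0 by convention if x is not in m^i). *)
Definition gr_class (i : nat) (x : R) : gr :=
  \pi_gr (insubd (0 : rees) (x *: 'X^i)).

(* The direct sum, inside gr, of the images of the A i (contained in m^i) in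
   m^i / m^(i+1). *)
Definition gr_direct_sum (A : nat -> set R) : set gr :=
  [set z | exists (n : nat) (f : nat -> R),
     (forall i, A i (f i)) /\ z = \sum_(i < n) gr_class i (f i)].

Definition gr_irrelevant : set gr :=
  gr_direct_sum (fun i => if i is 0%N then [set 0] else ideal_exp m i).

Definition initial_ideal (b : set R) : set gr :=
  gr_direct_sum (fun i => b `&` ideal_exp m i).

Lemma gr_class_val i x : ideal_exp m i x ->
  (insubd (0 : rees) (x *: 'X^i) : {poly R}) = x *: 'X^i.
Proof. by move=> /rees_monom_subproof Hx; exact: (insubdK 0 Hx). Qed.

Lemma gr_piP (f g : rees) :
  (\pi_gr f = \pi_gr g) <-> (forall i, ideal_exp m i.+1 (f`_i - g`_i)).
Proof.
have E : (\pi_gr f == \pi_gr g) = (f - g \in gr_ideal).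
  by rewrite (@Quotient.idealrBE rees gr_ideal f g).
have -> : (\pi_gr f = \pi_gr g) <-> f - g \in gr_ideal.
  by rewrite -E; split=> [->|/eqP].
by split=> [/asboolP H i|H]; [|apply/asboolP=> i];
  [have := H i|]; rewrite ?coefB.
Qed.

(* gr_class i embeds m^i / m^(i+1) as a group, the product is the graded one,
   and gr is the internal direct sum of these images. *)
Lemma gr_class_eq i x y : ideal_exp m i x -> ideal_exp m i y ->
  gr_class i x = gr_class i y <-> ideal_exp m i.+1 (x - y).
Proof.
move=> Hx Hy; rewrite gr_piP !gr_class_val //; split=> [/(_ i)|H j].
  by rewrite !coefZ coefXn eqxx !mulr1.
rewrite !coefZ coefXn; have [E0 _ _] := ideal_exp_ideal m j.+1.
by case: eqVneq => [->|_]; rewrite ?mulr1 // !mulr0 subr0.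
Qed.

Lemma gr_classD i x y : ideal_exp m i x -> ideal_exp m i y ->
  gr_class i (x + y) = gr_class i x + gr_class i y.
Proof.
move=> Hx Hy; have [_ ED _] := ideal_exp_ideal m i.
rewrite /gr_class -rmorphD; congr (\pi_gr _); apply: val_inj.
rewrite /= !gr_class_val ?scalerDl //; exact: ED.
Qed.

Lemma gr_classM i j x y : ideal_exp m i x -> ideal_exp m j y ->
  gr_class (i + j) (x * y) = gr_class i x * gr_class j y.
Proof.
move=> Hx Hy; rewrite /gr_class -rmorphM; congr (\pi_gr _); apply: val_inj.
rewrite /= !gr_class_val //; last exact: ideal_exp_mul.
by rewrite -scalerAl -scalerAr scalerA exprD.
Qed.

Lemma gr_class1 : gr_class 0 1 = 1.
Proof.
rewrite /gr_class -[RHS](rmorph1 \pi_gr); congr (\pi_gr _); apply: val_inj.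
by rewrite /= gr_class_val // scale1r.
Qed.

Lemma gr_sum_val n (f : nat -> R) : (forall i, ideal_exp m i (f i)) ->
  exists F : rees, \sum_(i < n) gr_class i (f i) = \pi_gr F
    /\ rees_val F = \poly_(i < n) f i.
Proof.
move=> Hf; exists (\sum_(i < n) insubd (0 : rees) (f i *: 'X^i)).
rewrite rmorph_sum; split=> //.
rewrite poly_def -[rees_val _]/(val _) rmorph_sum.
by apply: eq_bigr => i _; rewrite /= gr_class_val.
Qed.

Lemma gr_span : gr_direct_sum (ideal_exp m) = setT.
Proof.
apply/seteqP; split=> // z _; rewrite -[z]reprK; set f := repr z.
exists (size (f : {poly R})), (fun i => f`_i); split; first exact: reesP.
have [F [-> EF]] := gr_sum_val (size (f : {poly R})) (reesP f).
by congr (\pi_gr _); apply: val_inj; rewrite /= EF coefK.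
Qed.

Lemma gr_direct n (f : nat -> R) : (forall i, ideal_exp m i (f i)) ->
  \sum_(i < n) gr_class i (f i) = 0 ->
  forall i, (i < n)%N -> gr_class i (f i) = 0.
Proof.
move=> Hf; have [F [-> EF]] := gr_sum_val n Hf.
rewrite -(rmorph0 \pi_gr) => /gr_piP H i lt_in.
apply/gr_piP => j; rewrite gr_class_val // coef0 subr0 coefZ coefXn.
have [E0 _ _] := ideal_exp_ideal m j.+1.
case: eqVneq => [ej|_]; rewrite ?mulr1 ?mulr0 //.
by have := H j; rewrite EF coef0 subr0 coef_poly ej lt_in.
Qed.

End AssociatedGraded.

Arguments gr_direct_sum {R m} hm A _.
Arguments gr_irrelevant {R m} hm _.
Arguments initial_ideal {R m} hm b _.

(* Main.v *)
Require Import Defs.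
From mathcomp Require Import all_boot all_order all_algebra.
From mathcomp Require Import boolp classical_sets reals topology normedtype.
From mathcomp Require Import sequences.

Set Implicit Arguments.
Unset Strict Implicit.
Unset Printing Implicit Defensive.

Import Order.TTheory GRing.Theory Num.Theory.
Import numFieldNormedType.Exports.

Local Open Scope classical_set_scope.
Local Open Scope quotient_scope.
Local Open Scope ring_scope.

(** Write [n] for the irrelevant ideal of the graded ring and [I] for the
initial ideal of [b].  The inequality already holds between the integers
[nu m b q <= nu n I q], for every power [q] of [p].  Indeed the [q]-th power
of the leading form of [f] is zero or the leading form of [f^q], so [I^[q]] is
contained in the initial ideal of [b^[q]] ([initial_frob_power_sub]).  If
[n^t] lies in [I^[q]], then so does [n^s] for every [s >= t]; read in degree
[s], this says that [m^s] is contained in [b^[q] + m^(s+1)].  Iterating from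
[s = t] on, [m^t] is contained in [b^[q] + m^N] for all [N]
([ideal_exp_sub_of_initial]), and [m^N] is contained in [b^[q]] for [N] large
because [b] is [m]-primary ([ideal_exp_sub_frob]).

Comparing the limits requires that both exist.  If [a] is generated by [k]
elements, the pigeonhole principle on the exponents of monomials puts
[a^(q (k + s))] inside [(a^s)^[q]] ([ideal_exp_sub_frob_power]).  For [q = p]
this yields [nu a J (p^(e+1)) <= p (k + 1 + nu a J (p^e))], so the sequence
[nu a J (p^e) / p^e] increases by at most [(k + 1) / p^e] at step [e].  As
these bounds form a geometric series, the sequence becomes nonincreasing
after adding a multiple of [1 / p^e], hence it converges
([F_threshold_cvg]).  This applies to [n] because the leading forms of
generators of [m] generate it ([gr_irrelevant_gen]). *)

(** * Ideals and their generators *)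

Section IdealGenerators.
Context {A : comNzRingType}.
Implicit Types (a J : set A).

Lemma ideal0 J : ideal J -> J 0.
Proof. by case. Qed.

Lemma idealD J x y : ideal J -> J x -> J y -> J (x + y).
Proof. by case=> _ + _; apply. Qed.

Lemma idealMl J x y : ideal J -> J y -> J (x * y).
Proof. by case=> _ _; apply. Qed.

Lemma idealMr J x y : ideal J -> J x -> J (x * y).
Proof. by move=> HJ Jx; rewrite mulrC; apply: idealMl. Qed.

Lemma ideal_sum J (I : Type) (r : seq I) (P : pred I) (F : I -> A) :
  ideal J -> (forall i, P i -> J (F i)) -> J (\sum_(i <- r | P i) F i).
Proof.
move=> HJ HF; elim/big_ind: _ => //; first exact: ideal0.
by move=> x y; apply: idealD.
Qed.

Lemma ideal_gen_sub (S J : set A) : ideal J -> S `<=` J -> ideal_gen S `<=` J.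
Proof. exact: smallest_sub. Qed.

Lemma sub_ideal_gen (S : set A) : S `<=` ideal_gen S.
Proof. exact: sub_gen_smallest. Qed.

Lemma ideal_gen_subset (S T : set A) :
  S `<=` ideal_gen T -> ideal_gen S `<=` ideal_gen T.
Proof. exact: ideal_gen_sub (ideal_gen_ideal T). Qed.

Lemma ideal_colon J y : ideal J -> ideal [set x | J (x * y)].
Proof.
move=> HJ; split=> /= [|u v Hu Hv|c u Hu].
- by rewrite mul0r; apply: ideal0.
- by rewrite mulrDl; apply: idealD.
- by rewrite -mulrA; apply: idealMl.
Qed.

Lemma ideal_gen_mul_sub (S T J : set A) x y : ideal J ->
  (forall u v, S u -> T v -> J (u * v)) ->
  ideal_gen S x -> ideal_gen T y -> J (x * y).
Proof.
move=> HJ HST Sx Ty.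
apply: (ideal_gen_sub (ideal_colon y HJ) _ Sx) => u Su /=; rewrite mulrC.
apply: (ideal_gen_sub (ideal_colon u HJ) _ Ty) => v Tv /=; rewrite mulrC.
exact: HST.
Qed.

Lemma ideal_exp_le a s t : (s <= t)%N -> ideal_exp a t `<=` ideal_exp a s.
Proof.
move=> /subnK <-; elim: (t - s)%N => // n IHn x.
by rewrite addSn => /ideal_exp_subS; apply: IHn.
Qed.

Lemma ideal_expX a x n : a x -> ideal_exp a n (x ^+ n).
Proof.
move=> ax; elim: n => // n IHn.
by rewrite exprS; apply: ideal_mul_closed.
Qed.

Lemma ideal_exp_monomial a k (g : 'I_k -> A) (c : 'I_k -> nat) :
  (forall j, a (g j)) ->
  ideal_exp a (\sum_j c j)%N (\prod_j g j ^+ c j).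
Proof.
move=> ag; elim/big_ind2: _ => //; last by move=> j _; apply: ideal_expX.
by move=> x1 x2 y1 y2; apply: ideal_exp_mul.
Qed.

Definition monomials k (g : 'I_k -> A) (t : nat) : set A :=
  [set z | exists2 c : 'I_k -> nat,
     (\sum_j c j = t)%N & z = \prod_j g j ^+ c j].

Lemma ideal_exp_sub_monomials k (g : 'I_k -> A) t :
  ideal_exp (ideal_gen (range g)) t `<=` ideal_gen (monomials g t).
Proof.
elim: t => [|t IHt] x.
  move=> _; rewrite -[x]mulr1; apply: (idealMl _ (ideal_gen_ideal _)).
  apply: sub_ideal_gen; exists (fun=> 0%N); first by rewrite big1.
  by rewrite big1.
apply: (ideal_gen_sub (ideal_gen_ideal _)).
move=> _ [u [v [Hu Hv ->]]].
apply: (ideal_gen_mul_sub (ideal_gen_ideal _)) Hu (IHt _ Hv).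
move=> _ _ [j _ <-] [c ct ->]; apply: sub_ideal_gen.
exists (fun i => (i == j) + c i)%N.
  by rewrite big_split /= ct (bigD1 j) //= eqxx big1 ?addn0 // => i /negPf ->.
transitivity (\prod_i g i ^+ (i == j) * \prod_i g i ^+ c i); last first.
  by rewrite -big_split; apply: eq_bigr => i _; rewrite exprD.
congr (_ * _).
rewrite (bigD1 j) //= eqxx expr1 big1 ?mulr1 // => i /negPf ->.
by rewrite expr0.
Qed.

(** * Frobenius powers *)

(** Pigeonhole: writing each exponent [c j] as [q * d j + r j] with
[r j < q], a monomial of degree [q * (k + s)] in [k] generators is a multiple
of the [q]-th power of the monomial with exponents [d j], and the [d j] add up
to at least [s]. *)
Lemma ideal_exp_sub_frob_power k (g : 'I_k -> A) q s : (0 < q)%N ->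
  let a := ideal_gen (range g) in
  ideal_exp a (q * (k + s)) `<=` frob_power (ideal_exp a s) q.
Proof.
move=> q_gt0 a x /ideal_exp_sub_monomials.
apply: (ideal_gen_sub (ideal_gen_ideal _)).
move=> _ [c ct ->].
have le_s : (s <= \sum_j c j %/ q)%N.
  have : (q * (k + s) <= q * (k + \sum_j c j %/ q))%N.
    have sum_q : (\sum_(j < k) q = q * k)%N.
      by rewrite sum_nat_const card_ord mulnC.
    rewrite -ct mulnDr -sum_q big_distrr -big_split /=; apply: leq_sum => j _.
    rewrite {1}(divn_eq (c j) q) addnC [(q * _)%N]mulnC leq_add2r.
    by rewrite ltnW ?ltn_pmod.
  by rewrite leq_pmul2l // leq_add2l.
have -> : \prod_j g j ^+ c j =
    (\prod_j g j ^+ (c j %% q)) * (\prod_j g j ^+ (c j %/ q)) ^+ q.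
  rewrite -prodrXl -big_split; apply: eq_bigr => j _ /=.
  by rewrite -exprM -exprD addnC -divn_eq.
apply: (idealMl _ (ideal_gen_ideal _)).
apply: sub_ideal_gen; exists (\prod_j g j ^+ (c j %/ q)) => //.
apply: (ideal_exp_le le_s); apply: ideal_exp_monomial => j.
by apply: sub_ideal_gen; exists j.
Qed.

Lemma frob_power_subset J J' q :
  J `<=` J' -> frob_power J q `<=` frob_power J' q.
Proof.
move=> sJ; apply: ideal_gen_subset => _ [f Jf ->].
by apply: sub_ideal_gen; exists f => //; apply: sJ.
Qed.

Lemma ideal_preim_frob p e J : p \in [pchar A] -> ideal J ->
  ideal [set x : A | J (x ^+ (p ^ e))].
Proof.
move=> chA HJ; have p_pr := pcharf_prime chA.
have [q_gt0 q_nat] : (0 < p ^ e)%N /\ [pchar A].-nat (p ^ e)%N.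
  split; first by rewrite expn_gt0 prime_gt0.
  by rewrite pnatX (eq_pnat _ (pcharf_eq chA)) pnat_id.
split=> /= [|x y Jx Jy|c x Jx].
- by rewrite expr0n eqn0Ngt q_gt0; apply: ideal0.
- by rewrite exprDn_pchar //; apply: idealD.
- by rewrite exprMn; apply: idealMl.
Qed.

Lemma frob_power_comp p e J q : p \in [pchar A] ->
  frob_power (frob_power J q) (p ^ e) `<=` frob_power J (q * p ^ e).
Proof.
move=> chA; apply: (ideal_gen_sub (ideal_gen_ideal _)).
move=> _ [f Jf ->].
apply: (ideal_gen_sub (ideal_preim_frob e chA (ideal_gen_ideal _)) _ Jf).
move=> _ [h Jh ->] /=; rewrite -exprM.
by apply: sub_ideal_gen; exists h.
Qed.

(** As [x => x^(p^(e0 + e))] is additive, it maps all of [a], and not only the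
generators, into [J^[p^e]]; the pigeonhole bound with [s = 1] concludes. *)
Lemma ideal_exp_sub_frob p e e0 k (g : 'I_k -> A) J : p \in [pchar A] ->
  (forall j, J (g j ^+ (p ^ e0))) ->
  exists N, ideal_exp (ideal_gen (range g)) N `<=` frob_power J (p ^ e).
Proof.
move=> chA Jg; exists (p ^ (e0 + e) * (k + 1))%N => x.
move=> /ideal_exp_sub_frob_power.
rewrite expn_gt0 prime_gt0 ?(pcharf_prime chA) //.
rewrite ideal_exp1; last exact: ideal_gen_ideal.
move=> /(_ isT); apply: (ideal_gen_sub (ideal_gen_ideal _)).
move=> _ [f af ->].
apply: (ideal_gen_sub (ideal_preim_frob (e0 + e) chA (ideal_gen_ideal _)) _ af).
move=> _ [j _ <-] /=; rewrite expnD exprM.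
by apply: sub_ideal_gen; exists (g j ^+ (p ^ e0)).
Qed.

(** * Existence of the limit defining an F-threshold *)

Lemma nu_le a J q t : ideal_exp a t.+1 `<=` frob_power J q -> (nu a J q <= t)%N.
Proof.
move=> at1; rewrite /nu; case: xgetP => // s _ [Ts _].
by rewrite leqNgt; apply/negP => lt_ts; apply: Ts => x /(ideal_exp_le lt_ts) /at1.
Qed.

Lemma ideal_exp_nu a J q N : ideal_exp a N `<=` frob_power J q ->
  ideal_exp a (nu a J q).+1 `<=` frob_power J q.
Proof.
move=> aN; apply: contrapT => Tnu.
pose T : set nat := [set t | ~ (ideal_exp a t `<=` frob_power J q)].
have exP : exists t, `[< T t >] by exists (nu a J q).+1; apply/asboolP.
have ubP t : `[< T t >] -> (t <= N)%N.
  move=> /asboolP Tt; rewrite leqNgt; apply/negP => /ltnW le_Nt.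
  by apply: Tt => x /(ideal_exp_le le_Nt) /aN.
case: (ex_maxnP exP ubP) => t /asboolP Tt maxt.
have maxP : exists t, [set t | T t /\ forall s, T s -> (s <= t)%N] t.
  by exists t; split=> // s /asboolP; apply: maxt.
have [_ /(_ _ Tnu)] := xgetPex 0%N maxP.
by rewrite ltnn.
Qed.

(** With [C = k + 1], the sequence [u e = nu a J (p^e) / p^e] satisfies
[u (e+1) <= u e + C / p^e].  Since [2 <= p], the tail of the series of the
[C / p^i] from [i = e] on is at most [w e = 2 C / p^e]; hence [u + w] is
nonincreasing, and so is [w]. *)
Lemma F_threshold_cvg (K : realType) p k (g : 'I_k -> A) J e0 :
  p \in [pchar A] -> (forall j, J (g j ^+ (p ^ e0))) ->
  cvgn (fun e => (nu (ideal_gen (range g)) J (p ^ e))%:R / (p ^ e)%:R : K).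
Proof.
move=> chA Jg; set a := ideal_gen (range g).
have p_pr := pcharf_prime chA; have p_gt0 := prime_gt0 p_pr.
set u := (X in cvgn X).
have pe_gt0 e : 0 < (p ^ e)%:R :> K by rewrite ltr0n expn_gt0 p_gt0.
have nu_step e : (nu a J (p ^ e.+1) <= p * (k.+1 + nu a J (p ^ e)))%N.
  have [N aN] := ideal_exp_sub_frob e chA Jg.
  apply: nu_le => x /ideal_exp_subS; rewrite addSnnS.
  move=> /(ideal_exp_sub_frob_power p_gt0).
  move=> /(frob_power_subset (ideal_exp_nu aN)).
  rewrite -[X in frob_power _ X]expn1 => /(frob_power_comp chA).
  by rewrite -expnD addn1.
pose w e : K := 2 * k.+1%:R / (p ^ e)%:R.
have w_ge0 e : 0 <= w e by rewrite divr_ge0 ?mulr_ge0 ?ler0n.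
have u_ge0 e : 0 <= u e by rewrite divr_ge0 ?ler0n.
have w_step e : w e.+1 * p%:R = w e.
  rewrite /w expnSr natrM invfM mulrA mulfVK //.
  by rewrite pnatr_eq0 -lt0n.
have le2p : 2 <= p%:R :> K by rewrite (ler_nat _ 2) prime_gt1.
have w_half e : w e.+1 * 2 <= w e by rewrite -[leRHS]w_step ler_wpM2l.
have u_step e : u e.+1 <= u e + w e / 2.
  have -> : u e + w e / 2 = (k.+1 + nu a J (p ^ e))%:R / (p ^ e)%:R.
    by rewrite /w mulrAC [2 * _]mulrC mulfK ?pnatr_eq0 // -mulrDl -natrD addnC.
  rewrite ler_pdivrMr // [in leRHS]expnSr natrM mulrA divfK ?gt_eqF //.
  rewrite -natrM ler_nat mulnC.
  exact: nu_step.
have cvg_noninc (v : nat -> K) :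
    (forall e, 0 <= v e) -> (forall e, v e.+1 <= v e) -> cvgn v.
  move=> v_ge0 v_noninc; apply: nonincreasing_is_cvgn.
    by apply/nonincreasing_seqP.
  by exists 0 => _ [e _ <-].
have -> : u = (fun e => (u \+ w) e - w e).
  by apply/funext => e; rewrite /= addrK.
apply: (is_cvgB (f := u \+ w)); apply: cvg_noninc => e //=; first exact: addr_ge0.
  have : w e.+1 <= w e / 2 by rewrite ler_pdivlMr.
  move=> le_w; rewrite [X in _ <= u e + X](splitr (w e)) addrA.
  exact: lerD (u_step e) le_w.
by apply: le_trans (w_half e); rewrite ler_peMr // (ler_nat _ 1).
Qed.

End IdealGenerators.

(** * The associated graded ring *)

Section AssociatedGradedRing.
Context {R : comNzRingType} {m : set R} (hm : local_ring m).
Local Notation gr := (gr hm).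
Local Notation cl := (gr_class hm).

Lemma local_ring_ideal : ideal m.
Proof. by case: hm => -[]. Qed.

Lemma pchar_gr p : p \in [pchar R] -> p \in [pchar gr].
Proof.
move=> chR; rewrite inE (pcharf_prime chR) /=; apply/eqP.
rewrite -(rmorph_nat \pi_gr) -(rmorph0 \pi_gr); congr (\pi_gr _).
apply: val_inj; rewrite rmorph_nat rmorph0.
by rewrite -polyC_natr (pcharf0 chR).
Qed.

Lemma gr_class0 i : cl i 0 = 0.
Proof.
have mi0 := ideal0 (ideal_exp_ideal m i); have := gr_classD hm mi0 mi0.
by rewrite addr0 -[X in X = _]addr0 => /addrI.
Qed.

Lemma gr_classX i x n : ideal_exp m i x -> cl i x ^+ n = cl (i * n) (x ^+ n)
  /\ ideal_exp m (i * n) (x ^+ n).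
Proof.
move=> mx; elim: n => [|n [IHn mxn]].
  by rewrite muln0 !expr0 gr_class1.
rewrite !exprS mulnS IHn -gr_classM //; split=> //.
exact: ideal_exp_mul.
Qed.

Lemma ideal_preim_gr_class i (J : set gr) : ideal J ->
  ideal [set x | ideal_exp m i x /\ J (cl i x)].
Proof.
move=> HJ; have mi := ideal_exp_ideal m i; split=> /= [|x y|c x].
- by split; [exact: ideal0 | rewrite gr_class0; apply: ideal0].
- move=> [mx Jx] [my Jy]; split; first exact: idealD.
  by rewrite gr_classD //; apply: idealD.
- move=> [mx Jx]; split; first exact: idealMl.
  rewrite -[i]add0n gr_classM //; exact: idealMl.
Qed.

(** In positive degree a leading form is a sum of products of forms of degree
one, because [m^(i+1)] is generated by products of an element of [m] and one
of [m^i]. *)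
Lemma gr_class_ideal_exp (J : set gr) i x :
  (forall y, m y -> J (cl 1 y)) ->
  ideal_exp m i x -> ideal_exp J i (cl i x).
Proof.
move=> Jm; elim: i x => [//|i IHi] x mx.
have HJ := ideal_preim_gr_class i.+1 (ideal_exp_ideal J i.+1).
have [] // := ideal_gen_sub HJ _ mx.
move=> _ [y [z [my mz ->]]]; have my1 : ideal_exp m 1 y.
  by rewrite (ideal_exp1 local_ring_ideal).
split; first exact: ideal_mul_closed.
rewrite -[i.+1]/(1 + i)%N gr_classM //.
by apply: ideal_mul_closed; [exact: Jm | exact: IHi].
Qed.

Lemma gr_irrelevant_class1 y : m y -> gr_irrelevant hm (cl 1 y).
Proof.
move=> my; exists 2, (fun i => if i == 1%N then y else 0); split.
  have my1 : ideal_exp m 1 y by rewrite (ideal_exp1 local_ring_ideal).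
  by case=> [|[|i]] //; exact: ideal0 (ideal_exp_ideal m i.+2).
by rewrite big_ord_recr big_ord1 /= gr_class0 add0r.
Qed.

Lemma gr_irrelevant_class i y : ideal_exp m i y ->
  ideal_exp (gr_irrelevant hm) i (cl i y).
Proof. exact/gr_class_ideal_exp/gr_irrelevant_class1. Qed.

Lemma gen_gr_class1 k (g : 'I_k -> R) y : m = ideal_gen (range g) -> m y ->
  ideal_gen (range (fun j => cl 1 (g j))) (cl 1 y).
Proof.
move=> mg; have HJ := ideal_preim_gr_class 1
  (ideal_gen_ideal (range (fun j => cl 1 (g j)))).
rewrite {1}mg => my; have [] // := ideal_gen_sub HJ _ my.
move=> _ [j _ <-]; split; last by apply: sub_ideal_gen; exists j.
by rewrite (ideal_exp1 local_ring_ideal) mg; apply: sub_ideal_gen; exists j.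
Qed.

(** The second hypothesis says that the polynomials whose coefficient of each
degree [i] lies in [D i] absorb multiplication by the Rees algebra. *)
Lemma gr_homogeneous_ideal (D : nat -> set R) :
  (forall i, ideal (D i)) ->
  (forall i j x y, ideal_exp m i x -> D j y -> D (i + j)%N (x * y)) ->
  ideal [set z : gr | exists2 F : rees m, (forall i, D i F`_i) & z = \pi_gr F].
Proof.
move=> HD DM; split=> [|_ _ [F DF ->] [G DG ->]|z _ [F DF ->]].
- exists 0; last by rewrite rmorph0.
  by move=> i; rewrite coef0; apply: ideal0.
- exists (F + G); last by rewrite rmorphD.
  by move=> i; rewrite coefD; apply: idealD.
- rewrite -[z]reprK; set G := repr z; exists (G * F); last by rewrite rmorphM.
  move=> i; rewrite coefM; apply: ideal_sum => // -[j /= lt_ji] _.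
  rewrite -(subnKC (lt_ji : (j <= i)%N)); apply: DM; last by rewrite addKn.
  exact: reesP.
Qed.

Definition ideal_plus (c d : set R) : set R :=
  [set x | exists2 u, c u & d (x - u)].

Lemma ideal_plus_ideal c d : ideal c -> ideal d -> ideal (ideal_plus c d).
Proof.
move=> Hc Hd; split=> [|x y [u cu dx] [v cv dy]|a x [u cu dx]].
- by exists 0; rewrite ?subr0; apply: ideal0.
- exists (u + v); first exact: idealD.
  by rewrite opprD addrACA; apply: idealD.
- by exists (a * u); rewrite -?mulrBr; apply: idealMl.
Qed.

(** Only degree [0] is constrained: a class is in the irrelevant ideal if and
only if it is that of some [F] with [F_0] in [m]. *)
Lemma gr_irrelevant_ideal : ideal (gr_irrelevant hm).
Proof.
pose D i := if i is 0%N then m else [set: R].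
suff -> : gr_irrelevant hm =
    [set z : gr | exists2 F : rees m, (forall i, D i F`_i) & z = \pi_gr F].
  apply: gr_homogeneous_ideal => [[|i]|[|i] [|j] x y] //=.
    exact: local_ring_ideal.
  by move=> _; apply: idealMl local_ring_ideal.
apply/seteqP; split=> [_ [k [f [fP ->]]]|_ [F DF ->]].
  have fm i : ideal_exp m i (f i) by have := fP i; case: i => [|i].
  have [F [-> EF]] := gr_sum_val hm k fm; exists F => // -[|i] //=.
  rewrite EF coef_poly; have /= -> := fP 0%N.
  by case: ifP => _; apply: ideal0 local_ring_ideal.
pose f i := if i is 0%N then 0 else F`_i.
have fm i : ideal_exp m i (f i) by case: i => [//|i]; apply: reesP.
exists (size (F : {poly R})), f; split; first by case=> [//|i]; apply: reesP.
have [G [-> EG]] := gr_sum_val hm (size (F : {poly R})) fm.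
apply/gr_piP => i; rewrite EG coef_poly; case: ltnP => [lt_i|le_i].
  case: i {lt_i} => [|i].
  2: by rewrite subrr; apply: ideal0 (ideal_exp_ideal m i.+2).
  by rewrite subr0 (ideal_exp1 local_ring_ideal); apply: DF 0%N.
by rewrite nth_default // subrr; apply: ideal0 (ideal_exp_ideal _ _).
Qed.

Lemma gr_irrelevant_gen k (g : 'I_k -> R) : m = ideal_gen (range g) ->
  gr_irrelevant hm = ideal_gen (range (fun j => cl 1 (g j))).
Proof.
move=> mg; apply/seteqP; split; last first.
  apply: (ideal_gen_sub gr_irrelevant_ideal) => _ [j _ <-].
  by apply: gr_irrelevant_class1; rewrite mg; apply: sub_ideal_gen; exists j.
move=> _ [n [f [fP ->]]]; set J := ideal_gen _.
have HJ : ideal J by exact: ideal_gen_ideal.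
apply: ideal_sum => // -[i /= _] _; have := fP i; case: i => [->|i mf].
  by rewrite gr_class0; apply: ideal0.
rewrite -(ideal_exp1 HJ); apply: (@ideal_exp_le _ J 1 i.+1) => //.
by apply: gr_class_ideal_exp => // y; apply: gen_gr_class1.
Qed.

(** For an ideal [c], this is the initial ideal of [c], since an element of [c]
congruent modulo [m^(i+1)] to an element of [m^i] lies in [m^i].  In this form
the degree [i] component of a member can be read off directly. *)
Definition leading_forms (c : set R) : set gr :=
  [set z | exists2 F : rees m,
     (forall i, ideal_plus c (ideal_exp m i.+1) F`_i) & z = \pi_gr F].

Lemma leading_forms_ideal c : ideal c -> ideal (leading_forms c).
Proof.
move=> Hc; apply: (gr_homogeneous_ideal
  (D := fun i => ideal_plus c (ideal_exp m i.+1))).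
  by move=> i; apply: ideal_plus_ideal (ideal_exp_ideal _ _).
move=> i j x y mx [u cu my]; exists (x * u); first exact: idealMl.
by rewrite -mulrBr -addnS; apply: ideal_exp_mul.
Qed.

Lemma leading_forms_class c i u : ideal c -> c u -> ideal_exp m i u ->
  leading_forms c (cl i u).
Proof.
move=> Hc cu mu; exists (insubd (0 : rees m) (u *: 'X^i)) => // j.
rewrite gr_class_val // coefZ coefXn; exists (u * (j == i)%:R).
  exact: idealMr.
by rewrite subrr; apply: ideal0 (ideal_exp_ideal _ _).
Qed.

Lemma leading_forms_gr_class c i y : leading_forms c (cl i y) ->
  ideal_exp m i y -> ideal c -> ideal_plus c (ideal_exp m i.+1) y.
Proof.
move=> [F DF /gr_piP yF] my Hc.
have mS := ideal_exp_ideal m i.+1.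
rewrite -(subrK F`_i y); apply: idealD (DF i); first exact: ideal_plus_ideal.
exists 0; first exact: ideal0.
by have := yF i; rewrite gr_class_val // coefZ coefXn eqxx mulr1 subr0.
Qed.

(** The [q]-th power of the class of [f] in degree [i] is the class of [f^q] in
degree [i * q]; as raising to the power [q] is additive, the case of one
homogeneous component suffices. *)
Lemma initial_frob_power_sub p e (b : set R) : p \in [pchar R] ->
  frob_power (initial_ideal hm b) (p ^ e)
    `<=` leading_forms (frob_power b (p ^ e)).
Proof.
move=> chR; have Hb := leading_forms_ideal (ideal_gen_ideal
  [set z | exists2 f, b f & z = f ^+ (p ^ e)]).
apply: (ideal_gen_sub Hb) => _ [_ [n [f [fP ->]]] ->].
have HX := ideal_preim_frob e (pchar_gr chR) Hb.
apply: (ideal_sum (index_enum 'I_n) (P := xpredT)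
  (F := fun i => cl i (f i)) HX) => i _ /=.
have [bf mf] := fP i; have [-> mfq] := gr_classX (p ^ e) mf.
apply: leading_forms_class => //; first exact: ideal_gen_ideal.
by apply: sub_ideal_gen; exists (f i).
Qed.

(** * Comparison of the Frobenius powers *)

(** Successive approximation: an element of [m^s], with [s >= t], can be
corrected by an element of [b^[q]] so as to lie in [m^(s+1)]; after finitely
many corrections it lies in a power of [m] contained in [b^[q]]. *)
Lemma ideal_exp_sub_of_initial p e t N (b : set R) : p \in [pchar R] ->
  ideal_exp m N `<=` frob_power b (p ^ e) ->
  ideal_exp (gr_irrelevant hm) t `<=` frob_power (initial_ideal hm b) (p ^ e) ->
  ideal_exp m t `<=` frob_power b (p ^ e).
Proof.
move=> chR mN nt; set c := frob_power b (p ^ e).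
have Hc : ideal c by exact: ideal_gen_ideal.
suff approx n x : ideal_exp m t x -> ideal_plus c (ideal_exp m (t + n)) x.
  move=> x /(approx N) [u cu mx]; rewrite -(subrK u x); apply: (idealD Hc) => //.
  by apply: mN; apply: ideal_exp_le mx; exact: leq_addl.
move=> mx; elim: n => [|n [u cu mxu]].
  by exists 0; rewrite ?subr0 ?addn0 //; apply: ideal0.
have : leading_forms c (cl (t + n) (x - u)).
  apply: (initial_frob_power_sub chR); apply: nt.
  by apply: ideal_exp_le (gr_irrelevant_class mxu); exact: leq_addr.
move=> /leading_forms_gr_class /(_ mxu Hc) [v cv mxuv].
by exists (u + v); [exact: (idealD Hc) | rewrite addnS opprD addrA].
Qed.

Lemma gr_class_initial (b : set R) i y :
  ideal b -> b y -> ideal_exp m i y -> initial_ideal hm b (cl i y).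
Proof.
move=> Hb By my; exists i.+1, (fun j => if j == i then y else 0); split.
  move=> j; case: eqP => [->|_]; split=> //; first exact: ideal0.
  exact: ideal0 (ideal_exp_ideal _ _).
rewrite big_ord_recr /= eqxx big1 ?add0r // => j _.
by rewrite ltn_eqF // gr_class0.
Qed.

End AssociatedGradedRing.

Lemma radical_frob_exponent (R : comNzRingType) p k (g : 'I_k -> R) b :
  p \in [pchar R] -> ideal b -> (forall j, radical b (g j)) ->
  exists e, forall j, b (g j ^+ (p ^ e)).
Proof.
move=> chR Hb /choice [N bN]; exists (\max_j N j)%N => j.
have le_N : (N j <= p ^ \max_j N j)%N.
  apply: leq_trans (leq_bigmax j) (ltnW (ltn_expl _ _)).
  exact: prime_gt1 (pcharf_prime chR).
by rewrite -(subnK le_N) exprD; apply: idealMl.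
Qed.

Theorem theorem1 (K : realType) (R : comNzRingType) (p : nat)
    (chRp : p \in [pchar R]) (R_noetherian : noetherian R)
    (R_F_finite : F_finite chRp)
    (m : set R) (hm : local_ring m)
    (b : set R) (hb : primary_to m b) :
  F_threshold K p b m
    <= F_threshold K p (initial_ideal hm b) (gr_irrelevant hm).
Proof.
have [k [g mg]] := R_noetherian m (local_ring_ideal hm).
have [[Hb _ _] radb] := hb.
have mgj j : m (g j) by rewrite mg; apply: sub_ideal_gen; exists j.
have [e0 bg] : exists e0, forall j, b (g j ^+ (p ^ e0)).
  by apply: radical_frob_exponent => // j; rewrite radb.
have ng := gr_irrelevant_gen hm mg.
have chgr := pchar_gr hm chRp.
have Ig j : initial_ideal hm b (gr_class hm 1 (g j) ^+ (p ^ e0)).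
  have [|-> mgq] := gr_classX hm (i := 1) (x := g j) (p ^ e0).
    by rewrite (ideal_exp1 (local_ring_ideal hm)).
  exact: gr_class_initial.
apply: ler_lim.
- by rewrite mg; apply: F_threshold_cvg bg.
- by rewrite ng; apply: F_threshold_cvg Ig.
apply: nearW => e; rewrite ler_wpM2r ?invr_ge0 ?ler0n // ler_nat.
have [M bM] := ideal_exp_sub_frob e chRp bg.
have [N IN] := ideal_exp_sub_frob e chgr Ig.
apply: nu_le; apply: (ideal_exp_sub_of_initial chRp (N := M)).
  by rewrite mg.
by apply: (ideal_exp_nu (N := N)); rewrite ng.
Qed.
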